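(* Let $\mathit{rs}_K$ be a list of $K$ splitting rules. Suppose the objective function $E$ can be defined according to the recursive scheme $$E(\mathit{DL}(\mathit{ys}))=f(\mathit{ys}),\qquad E(\mathit{DN}(u,r,v))=g\big(E(\mathit{mapD}_{\cap r^{+}}(u)),\,E(\mathit{mapD}_{\cap r^{-}}(v))\big),\qquad g(a,b)\ge\max(a,b)$$ (that is, objectives for which the monotonicity implication recalled in the context holds). Define recursively $$\mathit{sodt}_{\text{rec}}(\mathit{xs},[\,])=\mathit{DL}(\mathit{xs}),\qquad \mathit{sodt}_{\text{rec}}(\mathit{xs},[r])=\mathit{DN}(\mathit{DL}(\mathit{xs}^{+}),r,\mathit{DL}(\mathit{xs}^{-})),$$ and otherwise $$\mathit{sodt}_{\text{rec}}(\mathit{xs},\mathit{rs})=\mathit{min}_{E}\big[\mathit{DN}(\mathit{sodt}_{\text{rec}}(\mathit{xs}^{+},\mathit{rs}^{+}),r,\mathit{sodt}_{\text{rec}}(\mathit{xs}^{-},\mathit{rs}^{-}))\mid(\mathit{rs}^{+},r,\mathit{rs}^{-})\leftarrow\mathit{splits}(\mathit{rs})\big].$$ Then $\mathit{sodt}_{\text{rec}}$ provides a solution to the brute-force specification $\mathit{min}_{E}\circ\mathit{genDTs}_{\text{rec}}(\mathit{xs})$, i.e. $$\mathit{sodt}_{\text{rec}}(\mathit{xs})\subseteq\mathit{min}_{E}\circ\mathit{genDTs}_{\text{rec}}(\mathit{xs}),$$ where ''$\subseteq$'' means that the solution on the left is one of the solutions on the right (one of the trees generated by $\mathit{genDTs}_{\text{rec}}$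 that are optimal with respect to $E$).
   Context: Data points lie in $\mathbb{R}^{D}$; a data list is a finite list of data points. A splitting rule $r$ subdivides the space into two disjoint connected regions $r^{+},r^{-}$. $\mathit{DTree}$ is the inductive type of binary trees that are either a leaf $\mathit{DL}(\mathit{ys})$ carrying a data list $\mathit{ys}$, or a node $\mathit{DN}(u,r,v)$ with left subtree $u$, rule $r$ and right subtree $v$. For a data list $\mathit{ys}$ and a region or list $S$, $\mathit{ys}\cap S$ is the sublist of elements of $\mathit{ys}$ lying in $S$. For the rule $r$ bound in the same expression, $\mathit{xs}^{\pm}=\mathit{xs}\cap r^{\pm}$. $\mathit{mapD}_{\cap S}$ replaces the data list $\mathit{ys}$ in every leaf of a tree by $\mathit{ys}\cap S$, leaving rules and shape unchanged. For a list of rules $r_1,\dots,r_K$ the ancestry relation matrix $\boldsymbol{K}$ has entries in $\{1,0,-1\}$ with $\boldsymbol{K}_{ii}=0$; $\boldsymbol{K}_{ij}=1$ (resp. $-1$) means that $r_j$ goes in the left (resp. right) subtree of $r_i$ when $r_i$ is an ancestor of $r_j$, and $\boldsymbol{K}_{ij}=0$ (for $i\ne j$) means that $r_i$ is not an ancestor of $r_j$. For $r_i$ in a list $\mathit{rs}$, $\mathit{rs}^{\pm}=[r_j\mid r_j\leftarrow\mathit{rs},\ \boldsymbol{K}_{ij}=\pm1]$, and $\mathit{splits}(\mathit{rs})$ is the list of triples $(\mathit{rs}^{+},r_i,\mathit{rs}^{-})$ over those $r_i$ in $\mathit{rs}$ with $\boldsymbol{K}_{ij}\ne0$ for all $r_j$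 in $\mathit{rs}$, $j\neq i$. The generator of decision trees with exactly the rules $\mathit{rs}$ is: $\mathit{genDTs}_{\text{rec}}(\mathit{xs},[\,])=[\mathit{DL}(\mathit{xs})]$, $\mathit{genDTs}_{\text{rec}}(\mathit{xs},[r])=[\mathit{DN}(\mathit{DL}(\mathit{xs}^{+}),r,\mathit{DL}(\mathit{xs}^{-}))]$, and otherwise $\mathit{genDTs}_{\text{rec}}(\mathit{xs},\mathit{rs})$ is the list of all $\mathit{DN}(\mathit{mapD}_{\cap \mathit{xs}^{+}}(u),r,\mathit{mapD}_{\cap \mathit{xs}^{-}}(v))$ with $(\mathit{rs}^{+},r,\mathit{rs}^{-})$ from $\mathit{splits}(\mathit{rs})$, $u$ from $\mathit{genDTs}_{\text{rec}}(\mathit{xs},\mathit{rs}^{+})$, $v$ from $\mathit{genDTs}_{\text{rec}}(\mathit{xs},\mathit{rs}^{-})$. In the scheme for $E$, $f$ maps data lists to $\mathbb{R}$ and $g:\mathbb{R}\times\mathbb{R}\to\mathbb{R}$. Monotonicity implication, asserted in the paper to hold trivially for objectives of this scheme: for a common root $r$ and subtrees $u,u',v,v'$, $E(\mathit{mapD}_{\cap r^{+}}(u))\le E(\mathit{mapD}_{\cap r^{+}}(u'))$ and $E(\mathit{mapD}_{\cap r^{-}}(v))\le E(\mathit{mapD}_{\cap r^{-}}(v'))$ imply $E(\mathit{DN}(u,r,v))\le E(\mathit{DN}(u',r,v'))$. $\mathit{min}_{E}$ selects an optimal tree from a list: $\mathit{min}_E([a])=a$, and $\mathit{min}_E(a:\mathit{as})=a$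 if $E(a)\le E(\mathit{min}_E(\mathit{as}))$, else $\mathit{min}_E(\mathit{as})$. *)

(* Defs.v *)
From Stdlib Require List.
From HB Require Import structures.
From mathcomp Require Import all_boot all_order all_algebra.
From mathcomp Require Import all_classical all_reals all_analysis.

Set Implicit Arguments.
Unset Strict Implicit.
Unset Printing Implicit Defensive.

Import Order.TTheory GRing.Theory Num.Theory.
Import numFieldNormedType.Exports.

Local Open Scope classical_set_scope.
Local Open Scope ring_scope.

Record rule (R : realType) (D : nat) := Rule {
  pos : set 'rV[R]_D;
  neg : set 'rV[R]_D;
  pos_neg_disjoint : pos `&` neg = set0;
  pos_neg_cover : pos `|` neg = setT;
  pos_connected : connected pos;
  neg_connected : connected neg
}.

Inductive DTree (R : realType) (D : nat) : Type :=
| DL of seq 'rV[R]_D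
| DN of DTree R D & rule R D & DTree R D.

Arguments DL {R D} _.
Arguments DN {R D} _ _ _.

(* [S] is a predicate so that it can be a region ([in pos r]) as well as a
   data list ([in xs]). *)
Definition cap (R : realType) (D : nat) (ys : seq 'rV[R]_D)
    (S : pred 'rV[R]_D) : seq 'rV[R]_D :=
  [seq y <- ys | S y].

Fixpoint mapD (R : realType) (D : nat) (S : pred 'rV[R]_D)
    (t : DTree R D) : DTree R D :=
  match t with
  | DL ys => DL (cap ys S)
  | DN u r v => DN (mapD S u) r (mapD S v)
  end.

(* [A i j = 1] (resp. [-1]): [r_j] goes in the left (resp. right) subtree of
   [r_i] whenever [r_i] is an ancestor of [r_j]; [0]: [r_i] is not an ancestor
   of [r_j]. *)
Record ancestry (K : nat) := Ancestry {
  ancestry_mx :> 'M[int]_K;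
  ancestry_entries : forall i j, ancestry_mx i j \in [:: 1; 0; -1];
  ancestry_diag : forall i, ancestry_mx i i = 0
}.

(* A sublist of the rules r_1, ..., r_K is represented by the list of its
   indices, since the ancestry matrix refers to rules by position; the whole
   list is [enum 'I_K]. *)
Definition rpos (K : nat) (A : ancestry K) (i : 'I_K) (rs : seq 'I_K) :
    seq 'I_K :=
  [seq j <- rs | A i j == 1].

Definition rneg (K : nat) (A : ancestry K) (i : 'I_K) (rs : seq 'I_K) :
    seq 'I_K :=
  [seq j <- rs | A i j == -1].

Definition splits (K : nat) (A : ancestry K) (rs : seq 'I_K) :
    seq (seq 'I_K * 'I_K * seq 'I_K) :=
  [seq (rpos A i rs, i, rneg A i rs) |
    i <- rs & all (fun j => (j != i) ==> (A i j != 0)) rs].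

(* The fuel [n] bounds the recursion depth; [size rs] always suffices, see
   [genDTsE]. *)
Fixpoint genDTs_fuel (R : realType) (D K : nat) (rl : K.-tuple (rule R D))
    (A : ancestry K) (n : nat) (xs : seq 'rV[R]_D) (rs : seq 'I_K) :
    seq (DTree R D) :=
  match rs, n with
  | [::], _ => [:: DL xs]
  | [:: i], _ =>
      let r := tnth rl i in
      [:: DN (DL (cap xs [in pos r])) r (DL (cap xs [in neg r]))]
  | _, 0%N => [::]
  | _, m.+1 =>
      flatten [seq
        let r := tnth rl s.1.2 in
        [seq DN (mapD [in cap xs [in pos r]] u) r
                (mapD [in cap xs [in neg r]] v) |
          u <- genDTs_fuel rl A m xs s.1.1,
          v <- genDTs_fuel rl A m xs s.2] | s <- splits A rs]
  end.

Definition genDTs (R : realType) (D K : nat) (rl : K.-tuple (rule R D))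
    (A : ancestry K) (xs : seq 'rV[R]_D) (rs : seq 'I_K) : seq (DTree R D) :=
  genDTs_fuel rl A (size rs) xs rs.

(* The minimum of the empty list is undefined, hence [None]. *)
Fixpoint minE (R : realType) (D : nat) (E : DTree R D -> R)
    (ts : seq (DTree R D)) : option (DTree R D) :=
  match ts with
  | [::] => None
  | a :: ts' =>
      match minE E ts' with
      | None => Some a
      | Some b => if E a <= E b then Some a else Some b
      end
  end.

Definition DN_opt (R : realType) (D : nat) (u : option (DTree R D))
    (r : rule R D) (v : option (DTree R D)) : option (DTree R D) :=
  match u, v with
  | Some u', Some v' => Some (DN u' r v')
  | _, _ => None
  end.

(* Some lists of rules form no tree at all (e.g. two rules neither of which is
   an ancestor of the other); [minE] then receives the empty list and the
   result is [None].  A split one of whose sides is undefined contributes no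
   candidate ([pmap]), exactly as it contributes no tree to [genDTs]. *)
Fixpoint sodt_fuel (R : realType) (D K : nat) (rl : K.-tuple (rule R D))
    (A : ancestry K) (E : DTree R D -> R) (n : nat) (xs : seq 'rV[R]_D)
    (rs : seq 'I_K) : option (DTree R D) :=
  match rs, n with
  | [::], _ => Some (DL xs)
  | [:: i], _ =>
      let r := tnth rl i in
      Some (DN (DL (cap xs [in pos r])) r (DL (cap xs [in neg r])))
  | _, 0%N => None
  | _, m.+1 =>
      minE E (pmap (fun s =>
        let r := tnth rl s.1.2 in
        DN_opt (sodt_fuel rl A E m (cap xs [in pos r]) s.1.1) r
               (sodt_fuel rl A E m (cap xs [in neg r]) s.2)) (splits A rs))
  end.

Definition sodt (R : realType) (D K : nat) (rl : K.-tuple (rule R D))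
    (A : ancestry K) (E : DTree R D -> R) (xs : seq 'rV[R]_D)
    (rs : seq 'I_K) : option (DTree R D) :=
  sodt_fuel rl A E (size rs) xs rs.

Definition monotone_objective (R : realType) (D : nat) (E : DTree R D -> R) :
    Prop :=
  forall (r : rule R D) (u u' v v' : DTree R D),
    E (mapD [in pos r] u) <= E (mapD [in pos r] u') ->
    E (mapD [in neg r] v) <= E (mapD [in neg r] v') ->
    E (DN u r v) <= E (DN u' r v').

(* [o] is one of the possible results of minimising [E] over [ts]: an optimal
   element of [ts], undefined exactly when [ts] is empty. *)
Definition refines_min (R : realType) (D : nat) (E : DTree R D -> R)
    (ts : seq (DTree R D)) (o : option (DTree R D)) : Prop :=
  match o with
  | Some t => List.In t ts /\ (forall t', List.In t' ts -> E t <= E t')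
  | None => ts = [::]
  end.

Lemma minE_refines (R : realType) (D : nat) (E : DTree R D -> R)
    (ts : seq (DTree R D)) : refines_min E ts (minE E ts).
Proof.
elim: ts => [//|a ts IH] /=.
case: (minE E ts) IH => [b [bin bmin]|/= ->] /=; last first.
  by split=> [|t' [<-|[]]]; [left|].
case: (leP (E a) (E b)) => [ab|/ltW ba].
  split; first by left.
  by move=> t' [<- //|/bmin]; apply: le_trans.
split; first by right.
by move=> t' [<- //|/bmin].
Qed.

Lemma size_splits (K : nat) (A : ancestry K) (rs : seq 'I_K) s :
  s \in splits A rs -> (size s.1.1 < size rs)%N && (size s.2 < size rs)%N.
Proof.
case/mapP => i; rewrite mem_filter => /andP[_ irs] -> /=.
rewrite !size_filter; apply/andP; split; rewrite -(count_predC (fun j => j == i)).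
  rewrite -[X in (X < _)%N]add0n -addSn leq_add //.
    by rewrite -has_count; apply/hasP; exists i.
  by apply: sub_count => j /=; apply: contraTneq => ->; rewrite ancestry_diag.
rewrite -[X in (X < _)%N]add0n -addSn leq_add //.
  by rewrite -has_count; apply/hasP; exists i.
by apply: sub_count => j /=; apply: contraTneq => ->; rewrite ancestry_diag.
Qed.

Lemma genDTs_fuelE (R : realType) (D K : nat) (rl : K.-tuple (rule R D))
    (A : ancestry K) (n : nat) (xs : seq 'rV[R]_D) (rs : seq 'I_K) :
  (size rs <= n)%N -> genDTs_fuel rl A n xs rs = genDTs rl A xs rs.
Proof.
move=> nrs; rewrite /genDTs.
suff H k m : (size rs <= k)%N -> (size rs <= m)%N ->
    genDTs_fuel rl A k xs rs = genDTs_fuel rl A m xs rs by exact: H.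
elim: k m rs {nrs} => [|k IH] [|m] [|i [|j rs]] // krs mrs.
rewrite [LHS]/= [RHS]/=; congr (flatten _); apply/eq_in_map => s /size_splits /andP[s1 s2].
have k1 := leq_trans s1 krs; have k2 := leq_trans s2 krs.
have m1 := leq_trans s1 mrs; have m2 := leq_trans s2 mrs.
by rewrite (IH m s.1.1 k1 m1) (IH m s.2 k2 m2).
Qed.

Lemma sodt_fuelE (R : realType) (D K : nat) (rl : K.-tuple (rule R D))
    (A : ancestry K) (E : DTree R D -> R) (n : nat) (xs : seq 'rV[R]_D)
    (rs : seq 'I_K) :
  (size rs <= n)%N -> sodt_fuel rl A E n xs rs = sodt rl A E xs rs.
Proof.
move=> nrs; rewrite /sodt.
suff H k m : (size rs <= k)%N -> (size rs <= m)%N ->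
    sodt_fuel rl A E k xs rs = sodt_fuel rl A E m xs rs by exact: H.
elim: k m xs rs {nrs} => [|k IH] [|m] xs [|i [|j rs]] // krs mrs.
rewrite [LHS]/= [RHS]/=; congr (minE _ _); apply: eq_in_pmap => s /size_splits /andP[s1 s2].
have k1 := leq_trans s1 krs; have k2 := leq_trans s2 krs.
have m1 := leq_trans s1 mrs; have m2 := leq_trans s2 mrs.
by rewrite (IH m _ s.1.1 k1 m1) (IH m _ s.2 k2 m2).
Qed.

Lemma genDTsE (R : realType) (D K : nat) (rl : K.-tuple (rule R D))
    (A : ancestry K) (xs : seq 'rV[R]_D) (rs : seq 'I_K) :
  genDTs rl A xs rs =
  match rs with
  | [::] => [:: DL xs]
  | [:: i] =>
      let r := tnth rl i in
      [:: DN (DL (cap xs [in pos r])) r (DL (cap xs [in neg r]))]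
  | _ =>
      flatten [seq
        let r := tnth rl s.1.2 in
        [seq DN (mapD [in cap xs [in pos r]] u) r
                (mapD [in cap xs [in neg r]] v) |
          u <- genDTs rl A xs s.1.1, v <- genDTs rl A xs s.2] |
        s <- splits A rs]
  end.
Proof.
case: rs => [|i [|j rs]] //.
have [n En] : exists n, size [:: i, j & rs] = n.+1 by exists (size rs).+1.
rewrite {1}/genDTs En [LHS]/=; congr (flatten _); apply/eq_in_map => s.
by move=> /size_splits; rewrite En !ltnS => /andP[s1 s2]; rewrite !genDTs_fuelE.
Qed.

Lemma sodtE (R : realType) (D K : nat) (rl : K.-tuple (rule R D))
    (A : ancestry K) (E : DTree R D -> R) (xs : seq 'rV[R]_D)
    (rs : seq 'I_K) :
  sodt rl A E xs rs =
  match rs with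
  | [::] => Some (DL xs)
  | [:: i] =>
      let r := tnth rl i in
      Some (DN (DL (cap xs [in pos r])) r (DL (cap xs [in neg r])))
  | _ =>
      minE E (pmap (fun s =>
        let r := tnth rl s.1.2 in
        DN_opt (sodt rl A E (cap xs [in pos r]) s.1.1) r
               (sodt rl A E (cap xs [in neg r]) s.2)) (splits A rs))
  end.
Proof.
case: rs => [|i [|j rs]] //.
have [n En] : exists n, size [:: i, j & rs] = n.+1 by exists (size rs).+1.
rewrite {1}/sodt En [LHS]/=; congr (minE _ _); apply: eq_in_pmap => s.
by move=> /size_splits; rewrite En !ltnS => /andP[s1 s2]; rewrite !sodt_fuelE.
Qed.

(* Main.v *)
(** Filtering the leaves of the trees generated from [xs] by a region gives the
    trees generated from the filtered list; so the brute-force generator obeys a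
    recursion which, like [sodt], passes [xs^+] and [xs^-] to its recursive
    calls.  The leaves of a generated left (right) subtree then already lie in
    [r^+] ([r^-]), so monotonicity of [E] compares nodes by the values of [E] on
    the subtrees themselves, and optimal subtrees yield an optimal node. *)

From Stdlib Require List.
Require Import Defs.
From HB Require Import structures.
From mathcomp Require Import all_boot all_order all_algebra.
From mathcomp Require Import all_classical all_reals all_analysis.

Set Implicit Arguments.
Unset Strict Implicit.
Unset Printing Implicit Defensive.

Import Order.TTheory GRing.Theory Num.Theory.

Local Open Scope ring_scope.

(** Trees carry rules, hence sets, and have no [eqType] structure, so membership of trees is
    [List.In]; splits do have one, and this bridges the two. *)
Lemma In_memP (T : eqType) (x : T) (s : seq T) :
  reflect (List.In x s) (x \in s).
Proof.
elim: s => [|y s IH] /=; first exact: ReflectF.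
by rewrite inE eq_sym; apply: (iffP predU1P) => -[]; rewrite -?(rwP IH); auto.
Qed.

Lemma In_flatten_map (S T : Type) (h : S -> seq T) (s : seq S) (t : T) :
  List.In t (flatten (map h s)) <-> exists x, List.In x s /\ List.In t (h x).
Proof.
by rewrite -List.in_flat_map List.flat_map_concat_map; apply: iff_refl.
Qed.

Lemma In_allpairs (S1 S2 T : Type) (h : S1 -> S2 -> T) (s1 : seq S1)
    (s2 : seq S2) (t : T) :
  List.In t [seq h x y | x <- s1, y <- s2] <->
  exists x y, [/\ List.In x s1, List.In y s2 & t = h x y].
Proof.
split=> [/In_flatten_map[x [xs1 /List.in_map_iff[y [<- ys2]]]]|].
  by exists x, y.
move=> [x [y [xs1 ys2 ->]]]; apply/In_flatten_map; exists x; split=> //.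
exact: List.in_map.
Qed.

Lemma In_pmap (S T : Type) (h : S -> option T) (s : seq S) (t : T) :
  List.In t (pmap h s) <-> exists x, List.In x s /\ h x = Some t.
Proof.
have -> : pmap h s = flatten (map (fun x => seq_of_opt (h x)) s).
  by elim: s => //= x s ->; case: (h x).
rewrite In_flatten_map; split=> -[x [xs hx]]; exists x; split=> //.
  by case: (h x) hx => //= y [->|].
by rewrite hx; left.
Qed.

Lemma map_id_In (T : Type) (h : T -> T) (s : seq T) (t : T) :
  map h s = s -> List.In t s -> h t = t.
Proof. by elim: s => [|y s IH] //= [hy hs] [<-|/(IH hs)]. Qed.

Section GeneratedTrees.
Variables (R : realType) (D K : nat) (rl : K.-tuple (rule R D)).
Variable A : ancestry K.
Implicit Types (S P : pred 'rV[R]_D) (xs : seq 'rV[R]_D) (rs : seq 'I_K).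

Lemma cap_comm xs S P : cap (cap xs S) P = cap (cap xs P) S.
Proof.
by rewrite /cap -!filter_predI; apply: eq_filter => x /=; rewrite andbC.
Qed.

Lemma cap_id xs S : cap (cap xs S) S = cap xs S.
Proof. exact: filter_id. Qed.

(** [genDTs] filters leaves by a data list rather than by a region; on sublists of [xs] itself the
    two filters agree, multiplicities included. *)
Lemma cap_in_cap xs S : cap xs [in cap xs S] = cap xs S.
Proof.
by apply: eq_in_filter => x xxs; rewrite /= mem_filter xxs andbT.
Qed.

Lemma allpairs_DN_mapD S P r (us vs : seq (DTree R D)) :
  [seq DN (mapD S u) r (mapD P v) | u <- us, v <- vs] =
  [seq DN u r v | u <- map (mapD S) us, v <- map (mapD P) vs].
Proof. by rewrite allpairs_mapl allpairs_mapr. Qed.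

Lemma map_mapD_genDTs S xs rs :
  map (mapD S) (genDTs rl A xs rs) = genDTs rl A (cap xs S) rs.
Proof.
have [n] := ubnP (size rs).
elim: n S xs rs => // n IH S xs [|i [|j rs]] rsn.
- by rewrite !genDTsE.
- by rewrite !genDTsE /= !(cap_comm _ _ S).
rewrite [in LHS]genDTsE [in RHS]genDTsE map_flatten -map_comp.
congr (flatten _); apply/eq_in_map => s /size_splits /andP[s1 s2] /=.
have {}s1 := leq_trans s1 rsn; have {}s2 := leq_trans s2 rsn.
(* All filters move onto the lists of subtrees, where the induction hypothesis turns them into
   filters on [xs]; these commute. *)
rewrite !allpairs_DN_mapD map_allpairs /= allpairs_DN_mapD.
by rewrite !IH // !cap_in_cap !(cap_comm _ _ S).
Qed.

Lemma genDTs_rec xs rs : (1 < size rs)%N ->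
  genDTs rl A xs rs =
  flatten [seq
    let r := tnth rl s.1.2 in
    [seq DN u r v | u <- genDTs rl A (cap xs [in pos r]) s.1.1,
                    v <- genDTs rl A (cap xs [in neg r]) s.2] |
    s <- splits A rs].
Proof.
case: rs => [|i [|j rs]] // _; rewrite genDTsE; congr (flatten _).
by apply: eq_map => s /=; rewrite allpairs_DN_mapD !map_mapD_genDTs !cap_in_cap.
Qed.

(** Filtering is idempotent, so [mapD S] fixes the whole generated list; since [map] preserves
    positions, it fixes each entry. *)
Lemma mapD_genDTs_id S xs rs t :
  List.In t (genDTs rl A (cap xs S) rs) -> mapD S t = t.
Proof. by apply: map_id_In; rewrite map_mapD_genDTs cap_id. Qed.

End GeneratedTrees.

(** [sodt] keeps at most one candidate per split; this reduces optimality among all generated trees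
    to domination by these candidates. *)
Lemma refines_min_dominating (R : realType) (D : nat) (E : DTree R D -> R)
    (cs ts : seq (DTree R D)) :
  (forall c, List.In c cs -> List.In c ts) ->
  (forall t, List.In t ts -> exists2 c, List.In c cs & E c <= E t) ->
  refines_min E ts (minE E cs).
Proof.
move=> csts dom; have := minE_refines E cs.
case: (minE E cs) => [c [cin cmin]|cs0] /=.
  by split=> [|t /dom[c' /cmin cc' c't]]; [exact: csts | exact: le_trans c't].
(* Without candidates nothing can dominate a tree of [ts], so [ts] is empty too. *)
by case: ts dom {csts} => // t ts /(_ t (or_introl erefl))[c]; rewrite cs0.
Qed.

Theorem theorem7 (R : realType) (D K : nat) (rl : K.-tuple (rule R D))
    (A : ancestry K) (E : DTree R D -> R)
    (f : seq 'rV[R]_D -> R) (g : R * R -> R)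
    (E_DL : forall ys : seq 'rV[R]_D, E (DL ys) = f ys)
    (E_DN : forall (u : DTree R D) (r : rule R D) (v : DTree R D),
      E (DN u r v) = g (E (mapD [in pos r] u), E (mapD [in neg r] v)))
    (g_max : forall a b : R, Num.max a b <= g (a, b))
    (E_mono : monotone_objective E)
    (xs : seq 'rV[R]_D) (rs : seq 'I_K) :
  refines_min E (genDTs rl A xs rs) (sodt rl A E xs rs).
Proof.
(* [xs] stays general in the induction because the recursive calls of [sodt] filter it. *)
have [n] := ubnP (size rs).
elim: n xs rs => // n IH xs rs rsn.
have [rs1|rs2] := leqP (size rs) 1.
  by case: rs rs1 {rsn} => [|i [|j rs]] // _;
    rewrite genDTsE sodtE; split=> [|t [<-|[]]] //; left.
rewrite genDTs_rec // sodtE.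
have sub s : List.In s (splits A rs) -> forall ys,
    refines_min E (genDTs rl A ys s.1.1) (sodt rl A E ys s.1.1) /\
    refines_min E (genDTs rl A ys s.2) (sodt rl A E ys s.2).
  move=> /In_memP /size_splits /andP[s1 s2] ys.
  by split; apply: IH; [apply: leq_trans s1 rsn | apply: leq_trans s2 rsn].
case: rs rs2 rsn sub => [|i [|j rs]] // _ _.
move: [:: i, j & rs] => {i j}rs sub.
apply: refines_min_dominating => t.
  (* Each candidate is generated, its two subtrees being so. *)
  move=> /In_pmap[s [srs]] /=; set r := tnth rl _.
  have [+ _] := sub s srs (cap xs [in pos r]).
  have [_ +] := sub s srs (cap xs [in neg r]).
  case: (sodt _ _ _ _ s.2) => [v|]; case: (sodt _ _ _ _ s.1.1) => [u|] //=.
  move=> [vin _] [uin _] [<-]; apply/In_flatten_map; exists s; split=> //.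
  by apply/In_allpairs; exists u, v.
move=> /In_flatten_map[s [srs /=]]; set r := tnth rl _.
move=> /In_allpairs[u' [v' [u'in v'in ->]]].
have [+ _] := sub s srs (cap xs [in pos r]).
have [_ +] := sub s srs (cap xs [in neg r]).
(* An undefined result would make the generated list empty, yet it contains [v']; likewise below for
   [u']. *)
case Ev: (sodt _ _ _ _ s.2) => [v|] /=; last by move=> vs0; rewrite vs0 in v'in.
move=> [vin vmin].
case Eu: (sodt _ _ _ _ s.1.1) => [u|] /=; last by move=> us0; rewrite us0 in u'in.
move=> [uin umin].
(* The dominating candidate joins the optimal subtrees of the same split. *)
exists (DN u r v).
  by apply/In_pmap; exists s; split=> //=; rewrite -/r Eu Ev.
apply: E_mono.
  by rewrite !(mapD_genDTs_id uin, mapD_genDTs_id u'in); apply: umin.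
by rewrite !(mapD_genDTs_id vin, mapD_genDTs_id v'in); apply: vmin.
Qed.
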